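(* Let $X$ be a finite CW complex and $k\ge 0$, and let $\Upsilon=\Upsilon(X,k)$ be the integer determined by the combinatorial structure of $X$ as defined in the context. Then for any integral homology class in $H_k(X;\mathbb{Z})$, the harmonic representative over $\mathbb{Q}$ of its image in $H_k(X;\mathbb{Q})$ has all its coefficients (with respect to the basis of $k$-cells) in $\mathbb{Z}[\Upsilon^{-1}]$.
   Context: $C_\bullet(X;R)$ is the cellular chain complex; $C_k(X;\mathbb{Q})$ has the $k$-cells as basis, and the codifferential $\partial_{k+1}^*:C_k(X;\mathbb{Q})\to C_{k+1}(X;\mathbb{Q})$ is the transpose of the cellular boundary $\partial_{k+1}$ in these bases. A chain $c\in C_k(X;\mathbb{Q})$ is harmonic if $\partial_kc=0$ and $\partial_{k+1}^*c=0$; over $\mathbb{Q}$ every homology class has a unique harmonic representative. A $k$-dimensional spanning cotree of $X$ is a subcomplex $L$ with $X^{(k-1)}\subseteq L\subseteq X^{(k)}$ such that the inclusion $L\to X$ induces isomorphisms $H_k(L;\mathbb{Q})\to H_k(X;\mathbb{Q})$ and $H_{k-1}(L;\mathbb{Q})\to H_{k-1}(X;\mathbb{Q})$. Its weight is $a_L=|H_k(X,L)|$, the order of the integral relative homology group, which is finite. Define $$\Upsilon(X,k)=\Big(\sum_L a_L^2\Big)\prod_L a_L,$$ the sum and product being over all $k$-dimensional spanning cotrees $L$ of $X$. For an integer $N$, $\mathbb{Z}[N^{-1}]$ is the localization of $\mathbb{Z}$ at $\{1,N,N^2,\dots\}$, viewed in $\mathbb{Q}$. *)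

(* Defs.v *)
From HB Require Import structures.
From mathcomp Require Import all_boot all_order all_algebra finmap.
From mathcomp Require Import freeg.
From mathcomp Require Import all_classical all_reals topology normedtype.
Import GRing.Theory Num.Theory numFieldNormedType.Exports.

Set Implicit Arguments.
Unset Strict Implicit.
Unset Printing Implicit Defensive.

Local Open Scope classical_set_scope.
Local Open Scope ring_scope.

Definition simplex_set (R : realType) (n : nat) : set 'rV[R]_n.+1 :=
  [set t | (forall i, 0 <= t 0 i) /\ \sum_i t 0 i = 1].
Definition simplex (R : realType) (n : nat) := set_type (@simplex_set R n).

Definition face_row (R : realType) (n : nat) (i : 'I_n.+2) (t : 'rV[R]_n.+1) :
    'rV[R]_n.+2 :=
  \row_j (if unlift i j is Some j' then t 0 j' else 0).

Lemma face_rowP (R : realType) (n : nat) (i : 'I_n.+2) (t : simplex R n) :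
  face_row i (set_val t) \in @simplex_set R n.+1.
Proof.
have [t0 t1] : simplex_set (set_val t) by exact: set_valP.
rewrite inE; split=> [j|]; first by rewrite mxE; case: unlift.
rewrite -t1 (bigD1_ord i) //= mxE unlift_none add0r.
by apply: eq_bigr => j _; rewrite mxE liftK.
Qed.

Definition face (R : realType) (n : nat) (i : 'I_n.+2) (t : simplex R n) :
  simplex R n.+1 := SigSub (face_rowP i t).

(* The free abelian group on ALL maps from the n-simplex to T; the group of
   singular n-chains of a subspace A is cut out by [chain_in A]. *)
Definition chain (R : realType) (n : nat) (T : Type) :=
  {freeg {classic simplex R n -> T} / int}.

Definition sbd (R : realType) (n : nat) (T : Type) :
    chain R n.+1 T -> chain R n T :=
  fglift (fun s : {classic simplex R n.+1 -> T} =>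
    \sum_(i < n.+2)
      (<< ((s : simplex R n.+1 -> T) \o face i : {classic simplex R n -> T}) >>
         : chain R n T) *~ (-1) ^+ i).

Definition spush (R : realType) (n : nat) (T U : Type) (f : T -> U) :
    chain R n T -> chain R n U :=
  fglift (fun s : {classic simplex R n -> T} =>
    << (f \o (s : simplex R n -> T) : {classic simplex R n -> U}) >>).

Definition chain_in (R : realType) (T : topologicalType) (A : set T) (n : nat)
    (c : chain R n T) : Prop :=
  forall s, s \in dom c ->
    continuous (s : simplex R n -> T) /\ range (s : simplex R n -> T) `<=` A.

Definition sbd_in (R : realType) (T : topologicalType) (B : set T) (n : nat) :
    chain R n T -> Prop :=
  if n is m.+1 then fun c => chain_in B (sbd c) else fun=> True.

(* Relative singular homology H_n(A, B) is handled through representatives: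
   relative cycles up to [rel_homologous]. *)
Definition rel_cycle (R : realType) (T : topologicalType) (A B : set T)
    (n : nat) (c : chain R n T) : Prop :=
  chain_in A c /\ sbd_in B c.

Definition rel_homologous (R : realType) (T : topologicalType) (A B : set T)
    (n : nat) (c c' : chain R n T) : Prop :=
  exists (d : chain R n.+1 T) (b : chain R n T),
    [/\ chain_in A d, chain_in B b & c - c' = sbd d + b].

Definition disk_set (R : realType) (k : nat) : set 'rV[R]_k :=
  [set x | \sum_i x 0 i ^+ 2 <= 1].
Definition disk (R : realType) (k : nat) := set_type (@disk_set R k).
Definition open_disk (R : realType) (k : nat) : set (disk R k) :=
  [set x | \sum_i (set_val x : 'rV[R]_k) 0 i ^+ 2 < 1].
Definition sphere (R : realType) (k : nat) : set (disk R k) :=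
  [set x | \sum_i (set_val x : 'rV[R]_k) 0 i ^+ 2 = 1].

(* With finitely many cells the closure-finiteness and weak-topology axioms of
   a CW complex follow from the fields below. *)
Record finite_cw (R : realType) := FiniteCW {
  cw_space :> topologicalType;
  ncells : nat -> nat;
  cw_char : forall k, 'I_(ncells k) -> disk R k -> cw_space;
  cw_hausdorff : hausdorff_space cw_space;
  cw_finite_dim : exists d, forall k, (d < k)%N -> ncells k = 0%N;
  cw_char_continuous : forall k (i : 'I_(ncells k)), continuous (cw_char i);
  cw_char_inj : forall k (i : 'I_(ncells k)),
    {in @open_disk R k &, injective (cw_char i)};
  cw_cells_cover :
    \bigcup_(p in [set: {k : nat & 'I_(ncells k)}])
      (cw_char (projT2 p) @` @open_disk R (projT1 p)) = [set: cw_space];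
  cw_cells_disjoint :
    trivIset [set: {k : nat & 'I_(ncells k)}]
      (fun p => cw_char (projT2 p) @` @open_disk R (projT1 p));
  cw_boundary : forall k (i : 'I_(ncells k)),
    cw_char i @` @sphere R k `<=`
      \bigcup_(p in [set p : {j : nat & 'I_(ncells j)} | (projT1 p < k)%N])
        (cw_char (projT2 p) @` @open_disk R (projT1 p))
}.

Definition cell (R : realType) (X : finite_cw R) (k : nat)
    (i : 'I_(ncells X k)) : set X :=
  cw_char i @` @open_disk R k.

(* The union of the cells of dimension strictly less than [k], that is
   X^(k-1); the k-skeleton is [skel X k.+1]. *)
Definition skel (R : realType) (X : finite_cw R) (k : nat) : set X :=
  \bigcup_(p in [set p : {j : nat & 'I_(ncells X j)} | (projT1 p < k)%N])
    cell (projT2 p).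

Arguments skel {R} X k.

(* A representative of a generator of H_k(D^k, S^(k-1); Z) = Z. *)
Definition fundamental_cycle (R : realType) (k : nat)
    (z : chain R k (disk R k)) : Prop :=
  rel_cycle setT (@sphere R k) z /\
  forall w, rel_cycle setT (@sphere R k) w ->
    exists m : int, rel_homologous setT (@sphere R k) w (z *~ m).

(* An orientation of each cell, with the cellular chain group
   C_k(X; Z) = H_k(X^(k), X^(k-1)) having the oriented cells as a basis.  By
   cellular homology [orient_basis] holds for every choice of fundamental
   cycles, so it does not restrict X or the orientations. *)
Record orientation (R : realType) (X : finite_cw R) := Orientation {
  orient_disk : forall k, 'I_(ncells X k) -> chain R k (disk R k);
  orient_fundamental : forall k (i : 'I_(ncells X k)),
    fundamental_cycle (orient_disk i);
  orient_basis : forall k (c : chain R k X),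
    rel_cycle (skel X k.+1) (skel X k) c ->
    exists! a : 'rV[int]_(ncells X k),
      rel_homologous (skel X k.+1) (skel X k) c
        (\sum_i spush (cw_char i) (orient_disk i) *~ a 0 i)
}.

Section CellularHomology.
Variables (R : realType) (X : finite_cw R) (o : orientation X).

Definition cell_class (k : nat) (i : 'I_(ncells X k)) : chain R k X :=
  spush (cw_char i) (orient_disk o i).

Definition cell_coord (k : nat) (c : chain R k X) : 'rV[int]_(ncells X k) :=
  xget (0 : 'rV[int]_(ncells X k))
    [set a : 'rV[int]_(ncells X k) | rel_homologous (skel X k.+1) (skel X k) c
                    (\sum_i cell_class i *~ a 0 i)].

(* Row [i] holds the incidence numbers of the i-th (k+1)-cell: the coordinates
   of its image under H_(k+1)(X^(k+1), X^(k)) -> H_k(X^(k), X^(k-1)). *)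
Definition incidence (k : nat) : 'M[int]_(ncells X k.+1, ncells X k) :=
  \matrix_i cell_coord (sbd (cell_class i)).

Variable A : comNzRingType.

(* Chains are row vectors, so the boundary of [c] is [c *m bdmx k] and the
   codifferential is [c |-> c *m (bdmx k.+1)^T].  In degree 0 the boundary is
   zero, with the placeholder target C_(0.-1) = C_0. *)
Definition bdmx (k : nat) : 'M[A]_(ncells X k, ncells X k.-1) :=
  match k with
  | 0 => 0
  | j.+1 => map_mx intr (incidence j)
  end.

Definition chains_on (S : set X) (k : nat) : set 'rV[A]_(ncells X k) :=
  [set c | forall i, c 0 i != 0 -> cell i `<=` S].

(* For subcomplexes T of S, H_k(S, T; A) is the set of cosets of the relative
   boundaries in the relative cycles; absolute homology is the case T = set0. *)
Definition cycles (S T : set X) (k : nat) : set 'rV[A]_(ncells X k) :=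
  [set c | chains_on S c /\ chains_on T (c *m bdmx k)].

Definition boundaries (S T : set X) (k : nat) : set 'rV[A]_(ncells X k) :=
  [set c | exists (d : 'rV[A]_(ncells X k.+1)) (t : 'rV[A]_(ncells X k)),
     [/\ chains_on S d, chains_on T t & c = d *m bdmx k.+1 + t]].

Definition hclass (S T : set X) (k : nat) (z : 'rV[A]_(ncells X k)) :
    set 'rV[A]_(ncells X k) :=
  [set w | boundaries S T (w - z)].

Definition homology (S T : set X) (k : nat) : set (set 'rV[A]_(ncells X k)) :=
  [set hclass S T z | z in @cycles S T k].

(* The map H_k(S; A) -> H_k(X; A) induced by the inclusion. *)
Definition hincl (k : nat) (a : set 'rV[A]_(ncells X k)) :
    set 'rV[A]_(ncells X k) :=
  \bigcup_(z in a) hclass setT set0 z.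

Definition hincl_iso (S : set X) (k : nat) : Prop :=
  set_bij (@homology S set0 k) (@homology setT set0 k) (@hincl k).

End CellularHomology.

Arguments cycles {R X} o A S T k.
Arguments boundaries {R X} o A S T k.
Arguments homology {R X} o A S T k.
Arguments hincl_iso {R X} o A S k.

Section SpanningCotrees.
Variables (R : realType) (X : finite_cw R) (o : orientation X) (k : nat).

Definition subcomplex (L : set X) : Prop :=
  closed L /\
  exists P : set {j : nat & 'I_(ncells X j)},
    L = \bigcup_(p in P) cell (projT2 p).

Definition spanning_cotree (L : set X) : Prop :=
  [/\ subcomplex L,
      skel X k `<=` L,
      L `<=` skel X k.+1,
      hincl_iso o rat L k &
      ((0 < k)%N -> hincl_iso o rat L k.-1)].

Definition cotree_weight (L : set X) : nat :=
  #|` fset_set (homology o int setT L k)|.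

Definition Upsilon : nat :=
  ((\big[addn/0]_(L \in spanning_cotree) cotree_weight L ^ 2) *
   (\big[muln/1]_(L \in spanning_cotree) cotree_weight L))%N.

Definition integral_class (a : set 'rV[int]_(ncells X k)) : Prop :=
  homology o int setT set0 k a.

Definition rational_image (a : set 'rV[int]_(ncells X k)) :
    set 'rV[rat]_(ncells X k) :=
  \bigcup_(z in a) hclass o setT set0 (map_mx intr z).

Definition harmonic (c : 'rV[rat]_(ncells X k)) : Prop :=
  c *m bdmx o rat k = 0 /\ c *m (bdmx o rat k.+1)^T = 0.

End SpanningCotrees.

(* Z[1/N] as a subring of the rationals. *)
Definition Zinv (N : nat) : set rat :=
  [set q | exists (a : int) (m : nat), q = a%:~R / N%:R ^+ m].

(* Main.v *)
(* Write B for the image of the cellular boundary of the (k+1)-chains.  Singular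
   chains show that the cellular boundary squares to zero, and then the
   k-dimensional spanning cotrees are the subcomplexes X^(k-1) + S, with S a set
   of k-cells, such that Q^S is a complement of B in Q^n.  Let the rows of M be a
   Z-basis of the lattice of integral boundaries (Smith normal form).  Q^S is a
   complement of B exactly when the columns of M outside S form a square
   nonsingular matrix, and the absolute value of its determinant is the index
   |H_k(X, L)| = a_L.  By Cauchy-Binet det (M M^T) is the sum of the a_L^2, and
   the harmonic representative of z is z - z M^T (M M^T)^-1 M, whose denominators
   divide det (M M^T), hence Upsilon. *)
From HB Require Import structures.
Require Import Defs.
From mathcomp Require Import all_boot all_order all_algebra finmap.
From mathcomp Require Import freeg.
From mathcomp Require Import zify.
From mathcomp Require Import all_classical all_reals topology normedtype.
Import Order.TTheory GRing.Theory Num.Theory numFieldNormedType.Exports.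

Set Implicit Arguments.
Unset Strict Implicit.
Unset Printing Implicit Defensive.

Local Open Scope classical_set_scope.
Local Open Scope card_scope.
Local Open Scope ring_scope.

(** * Cauchy-Binet and lattice indices *)

Section CauchyBinet.
Variables (A : comNzRingType) (r n : nat).
Implicit Types (M : 'M[A]_(r, n)) (P : 'M[A]_(n, r)) (T : {set 'I_n}).

(** Columns outside [T] are zeroed rather than deleted, so the size stays fixed and [T] need not be
    enumerated. *)
Definition colmask T M : 'M[A]_(r, n) := \matrix_(i, j) (M i j *+ (j \in T)).

(** Row [i] of [M *m P] combines the rows of [P] with coefficients [M i j], and the determinant is
    multilinear in its rows; [f] records the row of [P] chosen for each [i]. *)
Lemma det_mulmx_expand M P :
  \det (M *m P) =
  \sum_(f : {ffun 'I_r -> 'I_n}) (\prod_i M i (f i)) * \det (rowsub f P).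
Proof.
rewrite /determinant.
under eq_bigr => s _.
  under eq_bigr => i _ do rewrite mxE.
  rewrite bigA_distr_bigA mulr_sumr; over.
rewrite exchange_big; apply: eq_bigr => f _.
rewrite mulr_sumr; apply: eq_bigr => s _.
rewrite big_split /= mulrCA; congr (_ * (_ * _)).
by apply: eq_bigr => i _; rewrite mxE.
Qed.

Lemma det_rowsub_eq0 m (f : 'I_r -> 'I_m) (P : 'M[A]_(m, r)) :
  ~~ injectiveb f -> \det (rowsub f P) = 0.
Proof.
move=> /injectivePn[i [j ij fij]]; apply: (determinant_alternate ij) => l.
by rewrite !mxE fij.
Qed.

(* Each injective f : 'I_r -> 'I_n contributes for exactly one set T of
   cardinal r, namely its image; no reordering of columns is involved. *)
Lemma cauchy_binet_mask M P :
  \det (M *m P) = \sum_(T : {set 'I_n} | #|T| == r) \det (colmask T M *m P).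
Proof.
under eq_bigr => T _ do rewrite det_mulmx_expand.
rewrite det_mulmx_expand exchange_big /=; apply: eq_bigr => f _.
have [/injectiveP finj|fninj] := boolP (injectiveb f); last first.
  rewrite det_rowsub_eq0 // mulr0 big1 // => T _.
  by rewrite mulr0.
rewrite -mulr_suml; congr (_ * _).
have cardf : #|(f @: 'I_r)| = r by rewrite card_imset // card_ord.
rewrite (bigD1 (f @: 'I_r)) /=; last by rewrite cardf.
rewrite [X in _ + X]big1 ?addr0 => [|T /andP[/eqP cT nT]].
  by apply: eq_bigr => i _; rewrite mxE imset_f.
have /subsetPn[_ /imsetP[i _ ->] fiT] : ~~ ((f @: 'I_r) \subset T).
  apply: contra nT => sT; rewrite eq_sym eqEcard sT cT cardf leqnn //.
by rewrite (bigD1 i) //= mxE (negbTE fiT) mulr0n mul0r.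
Qed.

(** Both entries are sums of products over the image of [g]. Together with Cauchy-Binet this turns a
    Gram determinant into a sum of squares of maximal minors. *)
Lemma colmask_mul_tr (g : 'I_r -> 'I_n) M : injective g ->
  colmask (g @: 'I_r) M *m M^T = colsub g M *m (colsub g M)^T.
Proof.
move=> ginj; apply/matrixP => i j; rewrite !mxE.
rewrite (bigID (mem (g @: 'I_r))) /= [X in _ + X]big1 ?addr0.
  rewrite big_imset /=; last by move=> ? ? _ _; apply: ginj.
  by apply: eq_bigr => l _; rewrite !mxE imset_f.
by move=> l /negbTE lT; rewrite !mxE lT mulr0n mul0r.
Qed.

End CauchyBinet.

(** In a Smith normal form [A = L D Q] the nonzero rows of [D Q] are a basis of the row lattice of
    [A]. The factors [U] and [V] record that the two lattices agree; independence is stated over the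
    rationals. *)
Lemma integer_row_basis m n (A : 'M[int]_(m, n)) :
  exists (r : nat) (M : 'M[int]_(r, n)) (U : 'M[int]_(m, r)) (V : 'M[int]_(r, m)),
    [/\ A = U *m M, M = V *m A &
        forall y : 'rV[rat]_r, y *m map_mx intr M = 0 -> y = 0].
Proof.
have [L uL [Q uQ [d _ defA]]] := int_Smith_normal_form A.
(* Positions of the nonzero diagonal entries; indices beyond the length of [d] read the default 0
   and drop out. Pairs are kept because row and column indices have different types. *)
pose I := finset (fun p : 'I_m * 'I_n => (p.1 == p.2 :> nat) && (d`_(p.1) != 0)).
pose D : 'M[int]_(m, n) := \matrix_(i, j) (d`_i *+ (i == j :> nat)).
pose e (k : 'I_#|I|) := enum_val k.
have eI k : e k \in I by exact: enum_valP.
(* [E] keeps the nonzero rows of [D], [G] selects them, and [F] puts them back in place. *)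
pose E : 'M[int]_(#|I|, n) := \matrix_(k, j) (d`_((e k).1) *+ (j == (e k).2)).
pose F : 'M[int]_(m, #|I|) := \matrix_(i, k) (i == (e k).1)%:R.
pose G : 'M[int]_(#|I|, m) := \matrix_(k, i) (i == (e k).1)%:R.
have FE : F *m E = D.
  apply/matrixP => i j; rewrite !mxE.
  under eq_bigr => k _ do rewrite !mxE.
  rewrite -(big_enum_val (fun p : 'I_m * 'I_n =>
     (i == p.1)%:R * (d`_(p.1) *+ (j == p.2)) : int)) /=.
  have [ijI|ijI] := boolP ((i, j) \in I).
    rewrite (bigD1 (i, j)) //= !eqxx mul1r mulr1n big1 ?addr0.
      by move: ijI; rewrite inE /= => /andP[/eqP-> _]; rewrite eqxx.
    move=> [i' j'] /andP[_]; rewrite xpair_eqE negb_and /= [i == _]eq_sym [j == _]eq_sym.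
    by case/orP => /negbTE->; rewrite ?mul0r ?mulr0.
  rewrite big1 => [|[i' j'] /= ij'I].
    move: ijI; rewrite inE /= negb_and negbK => /orP[/negbTE->//|/eqP->].
    by rewrite mul0rn.
  case: (eqVneq i i') => [ii'|_]; last by rewrite mul0r.
  case: (eqVneq j j') => [jj'|_]; last by rewrite mulr0n mulr0.
  by rewrite ii' jj' ij'I in ijI.
have GD : G *m D = E.
  apply/matrixP => k j; rewrite !mxE (bigD1 (e k).1) //= big1 ?addr0.
    rewrite !mxE eqxx mul1r.
    by have := eI k; rewrite inE => /andP[/eqP-> _]; rewrite (inj_eq val_inj) eq_sym.
  by move=> i /negbTE ni; rewrite !mxE ni mul0r.
exists #|I|, (E *m Q), (L *m F), (G *m invmx L); split.
- by rewrite mulmxA -(mulmxA L) FE -defA.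
- by rewrite defA !mulmxA mulmxKV // -/D GD.
move=> y; rewrite map_mxM mulmxA => /(congr1 (mulmx^~ (invmx (map_mx intr Q)))).
rewrite mul0mx mulmxK; last by rewrite unitmxE det_map_mx rmorph_unit -?unitmxE.
move=> yE.
apply/rowP => k; rewrite mxE.
have /rowP/(_ (e k).2) := yE; rewrite !mxE (bigD1 k) //= big1 ?addr0.
  rewrite !mxE eqxx mulr1n => /eqP; rewrite mulf_eq0 => /orP[/eqP//|].
  rewrite intr_eq0.
  by have := eI k; rewrite inE => /andP[_ /negbTE->].
move=> l lk; rewrite !mxE; case: eqP => [ekl|_]; last by rewrite mulr0n mulr0.
case/eqP: lk; apply: enum_val_inj; rewrite -/(e l) -/(e k).
have := eI l; have := eI k; rewrite !inE => /andP[/eqP p1 _] /andP[/eqP p2 _].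
move: ekl p1 p2; case: (e l) => a b; case: (e k) => a' b' /= -> p1 p2.
by congr (_, _); apply: val_inj; rewrite /= p1 p2.
Qed.

(** The row space of [A] and the coordinate space of [S] meet only in 0 (first clause) and together
    span (second clause). The two clauses match injectivity and surjectivity in homology. *)
Definition complementary m n (A : 'M[rat]_(m, n)) (S : {set 'I_n}) : Prop :=
  (forall y : 'rV_m, (forall j, j \notin S -> (y *m A) 0 j = 0) -> y *m A = 0) /\
  (forall z : 'rV_n, exists y : 'rV_m,
     forall j, j \notin S -> (y *m A) 0 j = z 0 j).

(** Restriction to the coordinates outside [S] maps the row space of [M] isomorphically onto all
    vectors on these coordinates; hence there are [r] of them and the square matrix of these columns
    is invertible. *)
Lemma complementary_minor r n (M : 'M[int]_(r, n)) (S : {set 'I_n}) :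
  (forall y : 'rV[rat]_r, y *m map_mx intr M = 0 -> y = 0) ->
  complementary (map_mx intr M) S ->
  exists g : 'I_r -> 'I_n,
    [/\ injective g, ~: S = g @: 'I_r & \det (colsub g M) != 0].
Proof.
move=> Minj [S0 S1]; pose MQ := map_mx (intr : int -> rat) M.
(* The length [p] is left free: the fact is used for the enumeration of the complement of [S] to
   show that it has [r] elements, and again for [g]. *)
have free_colsub p (g : 'I_p -> 'I_n) :
    (forall j, j \notin S -> exists i, g i = j) ->
    row_free (colsub g MQ).
  move=> gS; apply: inj_row_free => y y0; apply: Minj; apply: S0 => j /gS[i <-].
  by move/rowP: y0 => /(_ i); rewrite mulmx_colsub !mxE.
pose e (i : 'I_#|~: S|) := enum_val i.
have eS i : e i \notin S by have := enum_valP i; rewrite inE.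
have e_inj : injective e by exact: enum_val_inj.
have eonto j : j \notin S -> exists i, e i = j.
  move=> jS; have jCS : j \in ~: S by rewrite inE.
  by exists (enum_rank_in jCS j); rewrite /e enum_rankK_in.
(* Freeness gives rank [r]. Each unit row on the complement of [S], extended by zero, is attained
   there by [S1], so the rank is also the number of columns. *)
have Sr : #|~: S| = r.
  have /eqP <- := free_colsub _ e eonto; apply/esym/eqP.
  rewrite -[_ == _]/(row_full _) -sub1mx; apply/row_subP => i.
  have [y yE] := S1 (\row_j
    (if pick (fun l => e l == j) is Some l then row i 1%:M 0 l else 0)).
  apply/submxP; exists y; rewrite mulmx_colsub; apply/rowP => l; rewrite [RHS]mxE yE // !mxE.
  case: pickP => [l' /eqP /e_inj->|/(_ l)]; first by rewrite !mxE.
  by rewrite eqxx.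
pose g (i : 'I_r) := e (cast_ord (esym Sr) i).
have gonto j : j \notin S -> exists i, g i = j.
  by move=> /eonto[i <-]; exists (cast_ord Sr i); rewrite /g cast_ordK.
exists g; split.
- by move=> i j /e_inj /cast_ord_inj.
- apply/setP => j; rewrite inE; apply/idP/imsetP => [/gonto[i <-]|[i _ ->]].
    by exists i.
  exact: eS.
have := free_colsub _ g gonto.
by rewrite row_free_unit -map_mxsub unitmxE det_map_mx unitfE intr_eq0.
Qed.

(** The coordinates outside [S] of a row-space vector [y *m M] form [y *m N]; inverting [N] recovers
    [y] from them and lets them be prescribed. *)
Lemma minor_complementary r n (M : 'M[int]_(r, n)) (S : {set 'I_n})
    (g : 'I_r -> 'I_n) :
  ~: S = g @: 'I_r -> \det (colsub g M) != 0 ->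
  complementary (map_mx intr M) S.
Proof.
move=> Sg dN; pose N := colsub g (map_mx (intr : int -> rat) M).
have uN : N \in unitmx.
  by rewrite /N -map_mxsub unitmxE det_map_mx unitfE intr_eq0.
have gS i : g i \notin S by rewrite -finset.in_setC Sg imset_f.
have gonto j : j \notin S -> exists i, g i = j.
  by rewrite -finset.in_setC Sg => /imsetP[i _ ->]; exists i.
split=> [y y0|z].
  suff -> : y = 0 by rewrite mul0mx.
  rewrite -[y](mulmxK uN) mulmx_colsub (_ : colsub g _ = 0) ?mul0mx //.
  by apply/rowP => i; rewrite mxE y0 // mxE.
exists (colsub g z *m invmx N) => j /gonto[i <-].
have /rowP/(_ i) : colsub g z *m invmx N *m N = colsub g z by rewrite mulmxKV.
by rewrite mulmx_colsub !mxE.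
Qed.

(** * Index of a full-rank lattice *)

Definition lattice_cosets r (N : 'M[int]_r) : set (set 'rV[int]_r) :=
  [set [set w | exists y : 'rV[int]_r, w - z = y *m N] | z in setT].

(** After a Smith normal form the cosets are represented by the box of residues below the absolute
    values of the diagonal entries, whose product is the absolute value of the determinant. *)
Lemma card_lattice_cosets r (N : 'M[int]_r) :
  \det N != 0 -> lattice_cosets N #= `I_(absz (\det N)).
Proof.
move=> dN; have [L uL [Q uQ [d _ defN]]] := int_Smith_normal_form N.
pose D := diag_mx (\row_(i < r) d`_i).
have {}defN : N = L *m D *m Q.
  by rewrite defN; congr (_ *m _ *m _); apply/matrixP => i j; rewrite !mxE.
have absz_unit (u : int) : u \is a GRing.unit -> absz u = 1%N.
  by rewrite unfold_in /= => /orP[]/eqP->.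
have detN : absz (\det N) = (\prod_(i < r) absz (d`_i)%R)%N.
  rewrite defN !det_mulmx !abszM (absz_unit (\det L)) // (absz_unit (\det Q)) // mul1n muln1.
  rewrite /D det_diag; elim/big_ind2: _ => // [a b a' b' <- <-|i _].
    by rewrite abszM.
  by rewrite mxE.
have dn0 i : (i < r)%N -> d`_i != 0.
  move=> ir; apply: contraNneq dN => di0; rewrite -absz_eq0 detN.
  by rewrite (bigD1 (Ordinal ir)) //= di0.
(* One bound for all residues, so that the box consists of functions into a single ordinal; the
   successor makes this ordinal inhabited, as [inord] requires. *)
pose K := (\sum_(i < r) absz (d`_i)%R).+1.
pose box := family (fun i : 'I_r => [pred x : 'I_K | (x < absz (d`_i)%R)%N]).
pose u (f : {ffun 'I_r -> 'I_K}) : 'rV[int]_r := (\row_i ((f i : nat) : int)) *m Q.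
pose cl (z : 'rV[int]_r) := [set w | exists y : 'rV[int]_r, w - z = y *m N].
have clE z : lattice_cosets N (cl z) by exists z.
(* In coordinates with respect to the rows of [Q], lattice membership is divisibility coordinate by
   coordinate. *)
have inN w : (exists y : 'rV[int]_r, w = y *m N) <->
    forall i : 'I_r, (d`_i %| (w *m invmx Q) ord0 i)%Z.
  split=> [[y ->] i|wd].
    by rewrite defN !mulmxA mulmxK // mul_mx_diag !mxE dvdz_mull.
  exists (\row_i ((w *m invmx Q) ord0 i %/ d`_i)%Z *m invmx L).
  rewrite defN !mulmxA mulmxKV // -[LHS](mulmxKV uQ); congr (_ *m _).
  apply/rowP => i; rewrite mul_mx_diag [RHS]mxE [X in X * _]mxE [X in _ * X]mxE. 
  by rewrite divzK.
have cardbox : #|box| = absz (\det N).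
  rewrite card_family detN foldrE big_map -big_enum /=; apply: eq_bigr => i _.
  have le_dK : (absz (d`_i)%R <= K)%N.
    by rewrite /K (bigD1 i) //= -addnS leq_addr.
  have widen_inj : injective (widen_ord le_dK).
    by move=> x y /(congr1 val) /= /val_inj.
  rewrite -[RHS]card_ord -(card_imset _ widen_inj).
  apply: eq_card => x; apply/idP/imsetP => [xd|[x' _ ->]]; last first.
    exact: (ltn_ord x').
  by exists (Ordinal xd) => //; apply: val_inj.
have cl_inj : {in [set f | f \in box] &, injective (cl \o u)}.
  move=> f f' /[!inE] /= fb fb' eqcl; apply/ffunP => i; apply: val_inj.
  have : cl (u f') (u f) by rewrite -eqcl /=; exists 0; rewrite subrr mul0mx.
  move/inN => /(_ i); rewrite -mulmxBl mulmxK // !mxE -eqz_mod_dvd.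
  move/familyP/(_ i): fb; move/familyP/(_ i): fb'; rewrite !inE => fb' fb.
  by rewrite -!(modz_abs _ d`_i) !modz_nat !modn_small // => /eqP[].
have -> : lattice_cosets N = (cl \o u) @` [set f | f \in box].
  apply/seteqP; split=> [_ [z _ <-]|_ [f _ <-]]; last exact: clE.
  (* The representative in the box is found by reducing each coordinate of [z *m invmx Q] modulo its
     diagonal entry. *)
  pose m i := ((z *m invmx Q) ord0 i %% d`_i)%Z.
  have m_ge0 (i : 'I_r) : 0 <= m i by rewrite modz_ge0 ?dn0.
  have m_lt (i : 'I_r) : (absz (m i) < absz (d`_i)%R)%N.
    by rewrite -ltz_nat gez0_abs // ltz_mod ?dn0.
  have mK (i : 'I_r) : (absz (m i) < K)%N.
    by rewrite /K ltnS (bigD1 i) //= (leq_trans (ltnW (m_lt i))) ?leq_addr.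
  exists [ffun i => inord (absz (m i))].
    by apply/familyP => i; rewrite ffunE inE inordK.
  suff zu : exists y, z - u [ffun i => inord (absz (m i))] = y *m N.
    have [y zuE] := zu; apply/seteqP; split=> w [y' wE]; rewrite /cl /=.
      by exists (y' - y); rewrite mulmxBl -zuE -wE opprB addrA subrK.
    by exists (y' + y); rewrite mulmxDl -zuE -wE addrA subrK.
  apply/inN => i; rewrite mulmxBl mulmxK // mxE [X in _ + X]mxE [X in - X]mxE ffunE inordK //.
  by rewrite gez0_abs // -eqz_mod_dvd modz_mod.
rewrite (card_eql (inj_card_eq cl_inj)) -cardbox cardE.
apply/card_set_bijP; exists (index^~ (enum box)); split.
- by move=> f /= fb; rewrite index_mem mem_enum.
- move=> f f' /[!inE] fb fb' /(congr1 (nth f (enum box))).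
  by rewrite !nth_index ?mem_enum.
move=> i /= ib; have [f0 _] : exists f, f \in box.
  by apply/card_gt0P; rewrite cardE (leq_ltn_trans _ ib).
exists (nth f0 (enum box) i); last by rewrite index_uniq ?enum_uniq.
by rewrite /= -mem_enum mem_nth.
Qed.

(** Complementarity depends only on the row space, which the two factorizations show to be common to
    both matrices. It thus passes between the boundary matrix and a basis of its lattice. *)
Lemma complementary_row_space m p n (A : 'M[rat]_(m, n)) (B : 'M[rat]_(p, n))
    (U : 'M_(m, p)) (V : 'M_(p, m)) (S : {set 'I_n}) :
  A = U *m B -> B = V *m A -> complementary A S -> complementary B S.
Proof.
move=> AU BV [S0 S1]; split=> [y|z].
  by rewrite BV mulmxA => /S0.
by have [y yS] := S1 z; exists (y *m U); rewrite -mulmxA -AU.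
Qed.

(** The quotient of [Z^n] by the row lattice of [A] plus [Z^S]: coordinates in [S] are left
    unconstrained. Relative homology of a candidate cotree takes this form. *)
Definition relative_cosets m n (A : 'M[int]_(m, n)) (S : {set 'I_n}) :
    set (set 'rV[int]_n) :=
  [set [set w | exists y : 'rV[int]_m,
         forall j, j \notin S -> (w - z) 0 j = (y *m A) 0 j] |
   z in [set: 'rV[int]_n]].

(** * The Gram determinant of a lattice basis *)

Section LatticeBasis.
Variables (m n r : nat) (A : 'M[int]_(m, n)) (M : 'M[int]_(r, n)).
Variables (U : 'M[int]_(m, r)) (V : 'M[int]_(r, m)).
Hypotheses (AU : A = U *m M) (MV : M = V *m A).
Hypothesis M_free : forall y : 'rV[rat]_r, y *m map_mx intr M = 0 -> y = 0.

(** Forgetting the coordinates in [S] identifies this quotient with [Z^r] modulo the row lattice of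
    [colsub g M], whose order is the absolute value of its determinant. *)
Lemma card_relative_cosets (g : 'I_r -> 'I_n) (S : {set 'I_n}) :
  injective g -> ~: S = g @: 'I_r -> \det (colsub g M) != 0 ->
  relative_cosets A S #= `I_(absz (\det (colsub g M))).
Proof.
move=> ginj Sg dN; rewrite -(card_eqr (card_lattice_cosets dN)).
have gS i : g i \notin S by rewrite -finset.in_setC Sg imset_f.
have gonto j : j \notin S -> exists i, g i = j.
  by rewrite -finset.in_setC Sg => /imsetP[i _ ->]; exists i.
(* Extension by zero is a section of [colsub g], so taking preimages under [colsub g] is injective
   on cosets. *)
pose lift_row (u : 'rV[int]_r) : 'rV[int]_n :=
  \row_j (if [pick i | g i == j] is Some i then u 0 i else 0).
have lift_rowK u : colsub g (lift_row u) = u.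
  apply/rowP => i; rewrite !mxE; case: pickP => [i' /eqP/ginj->//|/(_ i)].
  by rewrite eqxx.
pose pre (C : set 'rV[int]_r) := colsub g @^-1` C.
have pre_inj : {in lattice_cosets (colsub g M) &, injective pre}.
  have preE C u : pre C (lift_row u) = C u by rewrite /pre /preimage /= lift_rowK.
  by move=> C C' _ _ eqC; apply/funext => u; rewrite -preE eqC preE.
rewrite card_eq_sym -(card_eql (inj_card_eq pre_inj)).
suff preE z : pre [set w | exists y, w - colsub g z = y *m colsub g M] =
    [set w | exists y : 'rV[int]_m,
         forall j, j \notin S -> (w - z) 0 j = (y *m A) 0 j].
  suff -> : pre @` lattice_cosets (colsub g M) = relative_cosets A S by [].
  apply/seteqP; split=> [_ [_ [u _ <-] <-]|_ [z _ <-]].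
    by exists (lift_row u) => //; rewrite -preE lift_rowK.
  by rewrite -preE; eexists; last by []; exists (colsub g z).
apply/seteqP; split=> w [y wE]; last first.
  exists (y *m U); apply/rowP => i.
  by rewrite mulmx_colsub -mulmxA -AU [RHS]mxE -wE // !mxE.
exists (y *m V) => _ /gonto[i <-].
move/rowP: wE => /(_ i).
by rewrite mulmx_colsub {1}MV mulmxA !mxE.
Qed.

(** Cauchy-Binet writes the Gram determinant as a sum of squared maximal minors; a nonzero minor
    occurs exactly for a complement, where its absolute value is the index. *)
Lemma gram_det_index (wt : {set 'I_n} -> nat) :
  (forall S, complementary (map_mx intr A) S -> relative_cosets A S #= `I_(wt S)) ->
  ((\sum_(S | `[< complementary (map_mx intr A) S >]) wt S ^ 2)%N : int) =
  \det (M *m M^T).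
Proof.
move=> wtP; rewrite cauchy_binet_mask (big_morph _ PoszD (erefl (0 : int))).
(* Cauchy-Binet runs over the sets of retained columns, the weights over the sets of omitted
   ones. *)
rewrite (reindex_inj (@finset.setC_inj _)) /=.
have complAM S :
    complementary (map_mx intr A) S <-> complementary (map_mx intr M) S.
  split; [apply: (complementary_row_space (U := map_mx intr U) (V := map_mx intr V))
    |apply: (complementary_row_space (U := map_mx intr V) (V := map_mx intr U))];
    by rewrite -map_mxM -?AU -?MV.
have minorE g T : T = g @: 'I_r -> injective g ->
    \det (colmask T M *m M^T) = \det (colsub g M) ^+ 2.
  by move=> -> ginj; rewrite colmask_mul_tr // det_mulmx det_tr.
have wtE T : complementary (map_mx intr A) (~: T) -> #|T| = r /\
    ((wt (~: T) ^ 2)%N : int) = \det (colmask T M *m M^T).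
  move=> Tc; have /complAM/(complementary_minor M_free)[g [ginj Tg dN]] := Tc.
  have Tg' : T = g @: 'I_r by rewrite -Tg finset.setCK.
  split; first by rewrite Tg' card_imset // card_ord.
  rewrite (minorE _ _ Tg' ginj).
  have := card_relative_cosets ginj Tg dN; rewrite (card_eql (wtP _ Tc)).
  by move=> /card_eq_II->; rewrite -abszX gez0_abs // sqr_ge0.
rewrite [RHS](bigID (fun T => `[< complementary (map_mx intr A) (~: T) >])) /=.
rewrite [X in _ + X]big1 ?addr0 => [|T /andP[/eqP Tr nTc]].
  apply: eq_big => [T|T /asboolP/wtE[]//].
  by case: asboolP => [/wtE[->]|_]; rewrite ?eqxx ?andbF.
pose g i := enum_val (cast_ord (esym Tr) i).
have ginj : injective g by move=> i j /enum_val_inj/cast_ord_inj.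
have Tg : T = g @: 'I_r.
  apply/eqP; rewrite eq_sym eqEcard card_imset // card_ord Tr leqnn andbT.
  by apply/fintype.subsetP => _ /imsetP[i _ ->]; apply: enum_valP.
rewrite (minorE _ _ Tg ginj); apply/eqP; rewrite sqrf_eq0.
apply: contraNT nTc => dN; apply/asboolP/complAM.
by apply: (minor_complementary (g := g)); rewrite ?finset.setCK.
Qed.

(** Positive definiteness: if [y] is killed by the Gram matrix, then [v = y M] has sum of squares 0,
    so [v] and then [y] vanish. *)
Lemma gram_det_neq0 : \det (M *m M^T) != 0.
Proof.
rewrite -(intr_eq0 rat) -det_map_mx -unitfE -unitmxE -row_free_unit.
apply: inj_row_free => y; rewrite map_mxM -map_trmx mulmxA => y0.
apply: M_free; move: y0.
have [v vE] : exists v, v = y *m map_mx (intr : int -> rat) M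
  by exists (y *m map_mx intr M).
rewrite -vE => y0; apply/rowP => j; rewrite [RHS]mxE.
have /matrixP/(_ 0 0) : v *m v^T = 0.
  by rewrite {2}vE trmx_mul mulmxA y0 mul0mx.
rewrite !mxE => /eqP; rewrite psumr_eq0 => [/allP/(_ j)|i _].
  by rewrite mem_index_enum [v^T _ _]mxE mulf_eq0 orbb => /(_ isT)/eqP.
by rewrite [v^T _ _]mxE -expr2 sqr_ge0.
Qed.

Local Notation toQ B := (map_mx (intr : int -> rat) B).

(** Write [h = z + x M]. Orthogonality to the rows of [M] gives [x (M M^T) = - z M^T]; multiplying
    by the adjugate instead of the inverse makes [D x] integral, and with it [D h]. *)
Lemma gram_det_projection (z : 'rV[int]_n) (h : 'rV[rat]_n) (y : 'rV[rat]_m) :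
  h - map_mx intr z = y *m map_mx intr A -> h *m (map_mx intr A)^T = 0 ->
  exists w : 'rV[int]_n, (\det (M *m M^T))%:~R *: h = map_mx intr w.
Proof.
move=> hE hA; set D := \det _.
have hM : h *m (toQ M)^T = 0.
  by rewrite MV map_mxM trmx_mul mulmxA hA mul0mx.
pose x := y *m toQ U.
have hx : h = toQ z + x *m toQ M.
  by rewrite /x -mulmxA -map_mxM -AU -hE addrC subrK.
pose w := D *: z - z *m M^T *m \adj (M *m M^T) *m M; exists w.
have xG : x *m toQ (M *m M^T) = - toQ (z *m M^T).
  apply/eqP; rewrite -addr_eq0 !map_mxM -map_trmx mulmxA -mulmxDl addrC.
  by rewrite -hx hM.
have xD : D%:~R *: x = - toQ (z *m M^T *m \adj (M *m M^T)).
  rewrite map_mxM -mulNmx -xG -mulmxA -map_mxM.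
  by rewrite mul_mx_adj map_scalar_mx mul_mx_scalar.
rewrite hx scalerDr (scalemxAl _ x) xD /w map_mxB map_mxZ mulNmx.
by congr (_ - _); exact/esym/map_mxM.
Qed.

End LatticeBasis.

(** * Singular chains *)

Section SingularChains.
Variable R : realType.

Lemma freeg_additive_eq (K : choiceType) (V : zmodType)
    (f g : {additive {freeg K / int} -> V}) :
  (forall x, f << x >> = g << x >>) -> f =1 g.
Proof.
move=> fg c; rewrite -(freeg_sumE c) !raddf_sum; apply: eq_bigr => x _.
by rewrite -[coeff x c]intz -freegU_mulz !raddfMz fg.
Qed.

HB.instance Definition _ n T :=
  GRing.isZmodMorphism.Build _ _ (@sbd R n T) (lift_is_additive _).

HB.instance Definition _ n T U (f : T -> U) :=
  GRing.isZmodMorphism.Build _ _ (@spush R n T U f) (lift_is_additive _).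

Lemma sbdU n T (s : {classic simplex R n.+1 -> T}) :
  sbd << s >> = \sum_(i < n.+2)
    (<< ((s : simplex R n.+1 -> T) \o face i : {classic simplex R n -> T}) >>
       : chain R n T) *~ (-1) ^+ i.
Proof. by rewrite /sbd liftU scale1r. Qed.

Lemma spushU n T U (f : T -> U) (s : {classic simplex R n -> T}) :
  spush f << s >> =
    << (f \o (s : simplex R n -> T) : {classic simplex R n -> U}) >>.
Proof. by rewrite /spush liftU scale1r. Qed.

Lemma sbd_spush n T U (f : T -> U) (c : chain R n.+1 T) :
  sbd (spush f c) = spush f (sbd c).
Proof.
apply: (freeg_additive_eq (f := @sbd R n U \o spush f)
                          (g := spush f \o @sbd R n T)) => s /=.
rewrite spushU !sbdU raddf_sum; apply: eq_bigr => i _.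
by rewrite raddfMz /= spushU.
Qed.

(** The cosimplicial identity. The indices on the right are variables with prescribed values, since
    [j] and [i - 1] are needed in ordinals of other sizes than those of [j] and [i]. *)
Lemma face_row_face n (i : 'I_n.+3) (j : 'I_n.+2) (i' : 'I_n.+3) (j' : 'I_n.+2)
    (t : 'rV[R]_n.+1) :
  (j < i)%N -> i' = j :> nat -> j' = i.-1 :> nat ->
  face_row i (face_row j t) = face_row i' (face_row j' t).
Proof.
move=> ji ei ej; apply/rowP => l.
have face_lift m (a : 'I_m.+2) (u : 'rV[R]_m.+1) b :
    face_row a u 0 (fintype.lift a b) = u 0 b by rewrite mxE liftK.
have face0 m (a : 'I_m.+2) (u : 'rV[R]_m.+1) : face_row a u 0 a = 0.
  by rewrite mxE unlift_none.
(* Both composites insert zeros exactly at the positions [i] and [i'] and keep the other coordinates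
   in order. *)
have lifti : fintype.lift i j = i'.
  by apply: val_inj; rewrite /= /bump; move: ji ei ej; lia.
have lifti' : fintype.lift i' j' = i.
  by apply: val_inj; rewrite /= /bump; move: ji ei ej; lia.
have liftii' b : fintype.lift i (fintype.lift j b) = fintype.lift i' (fintype.lift j' b).
  by apply: val_inj; rewrite /= /bump; move: ji ei ej; lia.
case: (unliftP i l) => [l'|] ->; last by rewrite face0 -lifti' face_lift face0.
rewrite face_lift; case: (unliftP j l') => [l''|] ->.
  by rewrite face_lift liftii' !face_lift.
by rewrite face0 lifti face0.
Qed.

Lemma face_face n (i : 'I_n.+3) (j : 'I_n.+2) (i' : 'I_n.+3) (j' : 'I_n.+2) :
  (j < i)%N -> i' = j :> nat -> j' = i.-1 :> nat ->
  @face R n.+1 i \o face j = face i' \o face j'.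
Proof.
move=> ji ei ej; apply/funext => t; apply: val_inj => /=.
exact: face_row_face.
Qed.

(* (i, j) with j < i and (j, i - 1) index the same composite face with
   opposite signs. *)
Lemma sbd_sbd n T (c : chain R n.+2 T) : sbd (sbd c) = 0.
Proof.
apply: (freeg_additive_eq (f := @sbd R n T \o @sbd R n.+1 T) (g := \0)) => s /=.
rewrite sbdU raddf_sum /=.
pose G (p : 'I_n.+3 * 'I_n.+2) : {classic simplex R n -> T} :=
  (s : simplex R n.+2 -> T) \o face p.1 \o face p.2.
pose F p : chain R n T := << G p >> *~ ((-1) ^+ p.2 * (-1) ^+ p.1).
under eq_bigr => i _.
  rewrite raddfMz /= sbdU mulrz_suml.
  under eq_bigr => j _ do rewrite -mulrzA -[_ *~ _]/(F (i, j)).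
  over.
rewrite pair_bigA /= (eq_bigr F) => [|[i j] _ //].
(* The involution exchanges the pairs with [j < i] and the remaining ones, which it sends to
   [(j + 1, i)]. *)
pose sw (p : 'I_n.+3 * 'I_n.+2) : 'I_n.+3 * 'I_n.+2 :=
  if (p.2 < p.1)%N then (inord p.2, inord p.1.-1) else (inord p.2.+1, inord p.1).
have swK : involutive sw.
  move=> [i j]; rewrite /sw /=; case: (ltnP j i) => ji /=.
    have -> : (@inord n.+1 i.-1 < @inord n.+2 j)%N = false.
      by rewrite !inordK; move: (ltn_ord i) (ltn_ord j) ji; lia.
    by congr (_, _); apply: val_inj; rewrite /= !inordK;
       move: (ltn_ord i) (ltn_ord j) ji; lia.
  have -> : (@inord n.+1 i < @inord n.+2 j.+1)%N = true.
    by rewrite !inordK; move: (ltn_ord i) (ltn_ord j) ji; lia.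
  by congr (_, _); apply: val_inj; rewrite /= !inordK;
     move: (ltn_ord i) (ltn_ord j) ji; lia.
rewrite (bigID (fun p : 'I_n.+3 * 'I_n.+2 => (p.2 < p.1)%N)) /=.
rewrite [X in _ + X](reindex_inj (can_inj swK)) /=.
rewrite [X in _ + X](eq_bigl (fun p : 'I_n.+3 * 'I_n.+2 => (p.2 < p.1)%N)).
  rewrite -big_split big1 //= => -[i j] /= ji.
  rewrite /F /sw /= ji /=.
  have e1 : @inord n.+2 j = j :> nat.
    by rewrite inordK; move: (ltn_ord i) (ltn_ord j) ji; lia.
  have e2 : @inord n.+1 i.-1 = i.-1 :> nat.
    by rewrite inordK; move: (ltn_ord i) (ltn_ord j) ji; lia.
  have -> : G (i, j) = G (inord j, inord i.-1).
    apply/funext => t; congr (s _).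
    exact: (congr1 (fun f => f t) (face_face ji e1 e2)).
  rewrite -mulrzDr e1 e2.
  case: (nat_of_ord i) ji => // i0 _ /=; rewrite exprS mulN1r mulrN mulrC addNr.
  by rewrite mulr0z.
move=> [i j]; rewrite /sw /=; case: (ltnP j i) => ji /=;
  rewrite !inordK; move: (ltn_ord i) (ltn_ord j) ji; lia.
Qed.

Section ChainIn.
Variables (T : topologicalType) (A : set T).

Lemma chain_in0 n : chain_in A (0 : chain R n T).
Proof. by move=> s; rewrite dom0. Qed.

Lemma chain_inD n (c c' : chain R n T) :
  chain_in A c -> chain_in A c' -> chain_in A (c + c').
Proof.
move=> cA c'A s /domD_subset; rewrite mem_cat => /orP[]; [exact: cA|exact: c'A].
Qed.

Lemma chain_inN n (c : chain R n T) : chain_in A c -> chain_in A (- c).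
Proof. by move=> cA s; rewrite domN => /cA. Qed.

Lemma chain_inMz n (c : chain R n T) (m : int) : chain_in A c -> chain_in A (c *~ m).
Proof.
move=> cA; have cAn k : chain_in A (c *+ k).
  by elim: k => [|k IH]; rewrite ?mulrS; [exact: chain_in0|exact: chain_inD].
by case: m => k; [exact: cAn|apply: chain_inN; exact: cAn].
Qed.

Lemma chain_in_sum n (I : eqType) (r : seq I) (F : I -> chain R n T) :
  (forall i, i \in r -> chain_in A (F i)) -> chain_in A (\sum_(i <- r) F i).
Proof.
elim: r => [|i r IH] FA; first by rewrite big_nil; exact: chain_in0.
rewrite big_cons; apply: chain_inD; first by apply: FA; rewrite mem_head.
by apply: IH => j jr; apply: FA; rewrite inE jr orbT.
Qed.

End ChainIn.

Lemma chain_in_spush n (T U : topologicalType) (f : T -> U) (A : set T) (B : set U)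
    (c : chain R n T) :
  continuous f -> f @` A `<=` B -> chain_in A c -> chain_in B (spush f c).
Proof.
move=> fc fAB cA; rewrite -(freeg_sumE c) raddf_sum; apply: chain_in_sum => s sc.
rewrite -[coeff s c]intz -freegU_mulz raddfMz /= spushU; apply: chain_inMz => s'.
rewrite domU1 inE => /eqP->; have [s_cont sA] := cA _ sc; split.
  by move=> x; apply: continuous_comp; [exact: s_cont|exact: fc].
by move=> _ [x _ <-]; apply: fAB; exists (s x) => //; apply: sA; exists x.
Qed.

Lemma rel_homologous_sum n (T : topologicalType) (A B : set T) (I : finType)
    (a : I -> int) (c c' : I -> chain R n T) :
  (forall i, rel_homologous A B (c i) (c' i)) ->
  rel_homologous A B (\sum_i c i *~ a i) (\sum_i c' i *~ a i).
Proof.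
move=> cc'; have [d /choice[b cc'E]] := choice cc'.
exists (\sum_i d i *~ a i), (\sum_i b i *~ a i); split.
- by apply: chain_in_sum => i _; apply: chain_inMz; have [] := cc'E i.
- by apply: chain_in_sum => i _; apply: chain_inMz; have [] := cc'E i.
rewrite -sumrB (raddf_sum (@sbd R n T)) -big_split /=; apply: eq_bigr => i _.
by have [_ _ cE] := cc'E i; rewrite (raddfMz (@sbd R n T)) /= -mulrzBl cE mulrzDl.
Qed.

End SingularChains.

(** * Cells and incidence numbers *)

Section CWComplex.
Variables (R : realType) (X : finite_cw R).
Implicit Types (p q : {j : nat & 'I_(ncells X j)}).

(** Open cells are pairwise disjoint and contain the image of the centre of the disk, so inclusion
    of a cell in a union of cells is membership of its index. *)
Lemma cell_sub_bigcup (P : set {j : nat & 'I_(ncells X j)}) q :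
  cell (projT2 q) `<=` \bigcup_(p in P) cell (projT2 p) <-> P q.
Proof.
split=> [qP|Pq]; last by move=> x qx; exists q.
have zero_disk : 0 \in @disk_set R (projT1 q).
  by rewrite inE /disk_set /= big1 // => i _; rewrite mxE expr0n.
pose x : X := cw_char (projT2 q) (SigSub zero_disk).
have xq : cell (projT2 q) x.
  by exists (SigSub zero_disk) => //=; rewrite /open_disk /= big1 // => i _; rewrite mxE expr0n.
have [p Pp xp] := qP _ xq.
by have <- : p = q by apply: (cw_cells_disjoint (f := X)) => //; exists x.
Qed.

Lemma cell_sub_skel k q : cell (projT2 q) `<=` skel X k <-> (projT1 q < k)%N.
Proof. exact: cell_sub_bigcup. Qed.

(** * Incidence numbers and the square of the cellular boundary *)

Section Incidence.
Variable o : orientation X.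

(** The boundary of a fundamental cycle lies in the sphere, which the characteristic map sends into
    the lower skeleton. Hence the boundary of a cell class has cellular coordinates. *)
Lemma sbd_cell_class_rel_cycle k (i : 'I_(ncells X k.+1)) :
  rel_cycle (skel X k.+1) (skel X k) (sbd (cell_class o i)).
Proof.
have [[zD zS] _] := orient_fundamental o i.
split; last by case: k i zD zS => // k i _ _ /=; rewrite sbd_sbd; exact: chain_in0.
rewrite sbd_spush; apply: (chain_in_spush (A := @sphere R k.+1)) => //.
  exact: cw_char_continuous.
exact: cw_boundary.
Qed.

(** The basis property of the orientation provides coordinates, so [xget] does not fall back on its
    default value. *)
Lemma cell_coordP k (c : chain R k X) :
  rel_cycle (skel X k.+1) (skel X k) c ->
  rel_homologous (skel X k.+1) (skel X k) c
    (\sum_i cell_class o i *~ cell_coord o c 0 i).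
Proof.
move=> /(orient_basis o)[a [ca _]].
exact: (@xgetPex _ (0 : 'rV[int]_(ncells X k)) [set a : 'rV[int]_(ncells X k) |
  rel_homologous (skel X k.+1) (skel X k) c (\sum_i cell_class o i *~ a 0 i)]
  (ex_intro _ a ca)).
Qed.

(** The zero chain has unique cellular coordinates, so it is enough that each row of the product is
    a coordinate vector of it. *)
Lemma incidence_mul0 k : incidence o k.+1 *m incidence o k = 0.
Proof.
apply/row_matrixP => i; rewrite row_mul row0.
have rc0 : rel_cycle (skel X k.+1) (skel X k) (0 : chain R k X).
  split; first exact: chain_in0.
  by case: (k) => //= n; rewrite raddf0; exact: chain_in0.
have [a [_ a_uniq]] := orient_basis o rc0.
set u := row i _; set v := u *m _.
suff v0 : rel_homologous (skel X k.+1) (skel X k) (0 : chain R k X)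
    (\sum_l cell_class o l *~ v 0 l).
  rewrite -(a_uniq _ v0); apply: a_uniq; exists 0, 0.
  split; [exact: chain_in0|exact: chain_in0|].
  by rewrite big1 ?raddf0 ?subrr ?addr0 // => l _; rewrite mxE mulr0z.
have uE j : u 0 j = cell_coord o (sbd (cell_class o i)) 0 j by rewrite !mxE.
have [d [b [_ bS dE]]] := cell_coordP (sbd_cell_class_rel_cycle i).
have := rel_homologous_sum (u 0) (fun j => cell_coordP (sbd_cell_class_rel_cycle j)).
move=> [d' [b' [d'S b'S d'E]]].
(* The error [b] of the first relation lies in the k-skeleton and can join the chain whose boundary
   is taken. Applying the singular boundary to [dE] removes the other terms, as its square is
   zero. *)
exists (d' + b), b'; split=> //; first exact: chain_inD.
have /(congr1 (@sbd R _ _)) := dE.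
rewrite raddfB raddfD /= !sbd_sbd sub0r add0r => bE.
rewrite raddfD /= -bE (raddf_sum (@sbd R k X)) /= addrAC -d'E.
have -> : \sum_j sbd (cell_class o j *~ cell_coord o (sbd (cell_class o i)) 0 j)
    = \sum_j sbd (cell_class o j) *~ u 0 j.
  by apply: eq_bigr => j _; rewrite (raddfMz (@sbd R k X)) /= uE.
rewrite addrAC subrr; congr (_ - _).
under [RHS]eq_bigr => j _ do rewrite mulrz_suml.
rewrite exchange_big; apply: eq_bigr => l _ /=.
rewrite /v mxE mulrz_sumr; apply: eq_bigr => j _.
by rewrite -mulrzA mulrC mxE.
Qed.

End Incidence.

(** * Compactness of disks and closedness of closed cells *)

Lemma closed_disk_set k : closed (@disk_set R k).
Proof.
have sq_cont (i : 'I_k) : continuous (fun x : 'rV[R]_k => x 0 i ^+ 2).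
  move=> x; rewrite /continuous_at expr2; under eq_fun do rewrite expr2.
  have c := (@coord_continuous R 1 k 0 i x).
  exact: (cvgM c c).
have f_cont (r : seq 'I_k) :
    continuous (fun x : 'rV[R]_k => \sum_(i <- r) x 0 i ^+ 2).
  elim: r => [|i r IH].
    rewrite (_ : (fun _ => _) = fun=> 0); first exact: cst_continuous.
    by apply/funext => x; rewrite big_nil.
  rewrite (_ : (fun _ => _) = fun x : 'rV[R]_k => x 0 i ^+ 2 + \sum_(j <- r) x 0 j ^+ 2).
    by move=> x; have c := sq_cont i x; have d := IH x; exact: (cvgD c d).
  by apply/funext => x; rewrite big_cons.
by apply: (preimage_closed _ (@closed_le R 1)) => x _; exact: f_cont.
Qed.

Lemma compact_disk_set k : compact (@disk_set R k).
Proof.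
apply: (@subclosed_compact _ _
    [set v : 'rV[R]_k | forall i, v ord0 i \in `[(-1 : R), 1]]).
- exact: closed_disk_set.
- apply: (@rV_compact _ _ (fun=> `[(-1 : R), 1]%classic)) => _.
  exact: segment_compact.
move=> v v1 i; rewrite in_itv /= -ler_norml -(@expr_le1 _ 2) // real_normK ?num_real //.
apply: le_trans v1; rewrite (bigD1 i) //= lerDl.
by apply: sumr_ge0 => j _; rewrite sqr_ge0.
Qed.

(** A proper filter on the disk, pushed to the ambient space, clusters at a point of the compact
    disk; open sets of the disk are traces of ambient ones. *)
Lemma compact_disk k : compact [set: disk R k].
Proof.
move=> F FF _.
have FD : (fmap (set_val : disk R k -> 'rV[R]_k) F) (@disk_set R k).
  have FT : F setT by exact: filterT.
  by rewrite /fmap /=; apply: filterS FT => x _; exact: set_valP.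
have [x [Dx clx]] := compact_disk_set (fmap_proper_filter _ FF) FD.
have xD : x \in @disk_set R k by rewrite inE.
exists (SigSub xD); split=> // A B FA.
rewrite nbhsE => -[_ [[U oU <-] Ux] UB].
have [] := clx (set_val @` A) U.
- by rewrite /fmap /=; apply: filterS FA => a Aa; exists a.
- exact: open_nbhs_nbhs.
by move=> _ [[a Aa <-] Ua]; exists a; split=> //; apply: UB.
Qed.

Lemma closed_char k (i : 'I_(ncells X k)) : closed (cw_char i @` setT).
Proof.
apply: compact_closed; first exact: cw_hausdorff.
apply: continuous_compact; last exact: compact_disk.
by apply: continuous_subspaceT => x; exact: cw_char_continuous.
Qed.

End CWComplex.

(** * Spanning cotrees *)

Section CellularHomologyTheory.
Variables (R : realType) (X : finite_cw R) (o : orientation X).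

Lemma bdmx_mul0 (A : comNzRingType) k : bdmx o A k.+1 *m bdmx o A k = 0.
Proof.
case: k => [|k]; first by rewrite mulmx0.
by rewrite -map_mxM incidence_mul0 map_mx0.
Qed.

Section Coefficients.
Variables (A : comNzRingType) (k : nat).
Implicit Types (S : set X) (c z : 'rV[A]_(ncells X k)).

(** Cells are nonempty, so none lies in the empty set; this reduces relative homology with empty
    second term to the absolute one. *)
Lemma chains_on_set0 c : chains_on set0 c <-> c = 0.
Proof.
split=> [c0|-> i]; last by rewrite mxE eqxx.
apply/rowP => i; rewrite mxE; apply/eqP/negP => /negP/c0 ci0.
by apply: ((cell_sub_bigcup (X := X) set0 (existT _ k i)).1) => x /ci0.
Qed.

Lemma chains_on_subspace S :
  [/\ chains_on S (0 : 'rV[A]_(ncells X k)),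
      forall c c', chains_on S c -> chains_on S c' -> chains_on S (c + c') &
      forall c, chains_on S c -> chains_on S (- c)].
Proof.
split=> [i|c c' cS c'S i|c cS i]; first by rewrite mxE eqxx.
  rewrite mxE; have [/eqP c0|/cS//] := boolP (c 0 i == 0).
  by rewrite c0 add0r => /c'S.
by rewrite mxE oppr_eq0 => /cS.
Qed.
End Coefficients.

Section Inclusion.
Variables (A : comNzRingType) (k : nat).
Implicit Types (S : set X) (c z : 'rV[A]_(ncells X k)).

Lemma boundaries_set0 S c : boundaries o A S set0 k c <->
  exists2 d, chains_on S d & c = d *m bdmx o A k.+1.
Proof.
split=> [[d [t [dS /chains_on_set0-> ->]]]|[d dS ->]]; exists d; rewrite ?addr0 //.
by exists 0; split; rewrite ?addr0 //; apply/chains_on_set0.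
Qed.

Lemma boundariesB S T c c' : boundaries o A S T k c ->
  boundaries o A S T k c' -> boundaries o A S T k (c - c').
Proof.
move=> [d [t [dS tT ->]]] [d' [t' [d'S t'T ->]]]; exists (d - d'), (t - t').
have [_ DS NS] := chains_on_subspace A k.+1 S.
have [_ DT NT] := chains_on_subspace A k T.
split; [by apply/DS/NS|by apply/DT/NT|].
by rewrite mulmxBl opprD !addrA; congr (_ - _); rewrite addrAC.
Qed.

Lemma boundaries0 S T : boundaries o A S T k 0.
Proof.
have [S0 _ _] := chains_on_subspace A k.+1 S.
have [T0 _ _] := chains_on_subspace A k T.
by exists 0, 0; split; rewrite // mul0mx addr0.
Qed.

Lemma hclass_eq S T z z' :
  hclass o S T z = hclass o S T z' <-> boundaries o A S T k (z - z').
Proof.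
split=> [zz'|bzz'].
  have : hclass o S T z z by rewrite /hclass /= subrr; exact: boundaries0.
  by rewrite zz'.
apply/seteqP; split=> w /= wz.
  rewrite /hclass /=; have -> : w - z' = (w - z) - (0 - (z - z')).
    by rewrite sub0r opprK addrA subrK.
  by apply: boundariesB => //; apply: boundariesB => //; exact: boundaries0.
rewrite /hclass /=; have -> : w - z = (w - z') - (z - z').
  by rewrite opprB addrA subrK.
exact: boundariesB.
Qed.

Lemma hincl_hclass S z : hincl o (hclass o S set0 z) = hclass o setT set0 z.
Proof.
have subb c : boundaries o A S set0 k c -> boundaries o A setT set0 k c.
  by move=> [d [t [_ tT ->]]]; exists d, t.
apply/seteqP; split=> [w [z' zz' wz']|w wz].
  by rewrite -((hclass_eq setT set0 z' z).2 (subb _ zz')).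
by exists z => //; rewrite /hclass /= subrr; exact: boundaries0.
Qed.

(** Bijectivity on cosets is rephrased on representatives; by additivity, injectivity becomes
    triviality of the kernel. *)
Lemma hincl_isoP S : hincl_iso o A S k <->
  (forall z, cycles o A S set0 k z -> boundaries o A setT set0 k z ->
     boundaries o A S set0 k z) /\
  (forall z, cycles o A setT set0 k z -> exists2 z', cycles o A S set0 k z' &
     boundaries o A setT set0 k (z - z')).
Proof.
split=> [[_ inj surj]|[inj surj]].
  split=> [z zS zb|z zc].
    rewrite -[z]subr0; apply/hclass_eq; apply: inj; rewrite ?inE.
    - by exists z.
    - exists 0 => //; split; first by have [] := chains_on_subspace A k S.
      by rewrite mul0mx; apply/chains_on_set0.
    by rewrite !hincl_hclass; apply/hclass_eq; rewrite subr0.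
  have [|_ [z' z'S <-]] := surj (hclass o setT set0 z); first by exists z.
  by rewrite hincl_hclass => /esym/hclass_eq zz'; exists z'.
split.
- move=> _ [z [zS zd] <-]; rewrite hincl_hclass; exists z => //; split=> //.
- move=> a b /[!inE] -[z zS <-] [z' z'S <-].
  rewrite !hincl_hclass => /hclass_eq zz'; apply/hclass_eq; apply: inj => //.
  have [zc zd] := zS; have [z'c z'd] := z'S.
  have [_ DS NS] := chains_on_subspace A k S.
  split; first by apply/DS/NS.
  rewrite mulmxBl ((chains_on_set0 _).1 zd) ((chains_on_set0 _).1 z'd) subrr.
  exact/chains_on_set0.
move=> _ [z zc <-]; have [z' z'S zz'] := surj z zc.
exists (hclass o S set0 z'); first by exists z'.
by rewrite hincl_hclass; apply/esym/hclass_eq.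
Qed.

End Inclusion.
End CellularHomologyTheory.

(** * Subcomplexes between consecutive skeleta *)

Section SpanningCotreeTheory.
Variables (R : realType) (X : finite_cw R) (o : orientation X) (k : nat).
Implicit Types (S : {set 'I_(ncells X k)}) (L : set X).

Definition cells_in L : {set 'I_(ncells X k)} :=
  finset (fun i : 'I_(ncells X k) => `[< cell i `<=` L >]).

Definition cotree_cells S : set {j : nat & 'I_(ncells X j)} :=
  [set p | (projT1 p < k)%N \/ exists2 i, i \in S & p = existT _ k i].

Definition skel_with S : set X := \bigcup_(p in cotree_cells S) cell (projT2 p).

Lemma existT_inj j (i i' : 'I_(ncells X j)) :
  existT (fun j => 'I_(ncells X j)) j i = existT _ j i' -> i = i'.
Proof. by move=> /eqP; rewrite eq_Tagged => /eqP. Qed.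

Lemma cell_sub_skel_with S (i : 'I_(ncells X k)) :
  cell i `<=` skel_with S <-> i \in S.
Proof.
split=> [/(cell_sub_bigcup (cotree_cells S) (existT _ k i))[/=|[i' i'S]]|iS].
- by rewrite ltnn.
- by move=> /existT_inj->.
by apply/(cell_sub_bigcup (cotree_cells S) (existT _ k i)); right; exists i.
Qed.

Lemma cells_in_skel_with S : cells_in (skel_with S) = S.
Proof.
apply/setP => i; rewrite inE; apply/asboolP/idP => /cell_sub_skel_with //.
Qed.

Lemma skel_sub_skel_with S : skel X k `<=` skel_with S.
Proof. by apply: bigcup_subset => p pk; left. Qed.

Lemma skel_with_sub_skel S : skel_with S `<=` skel X k.+1.
Proof.
by apply: bigcup_subset => p [/ltnW//|[i _ -> /=]]; rewrite ltnSn.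
Qed.

(** Such a subcomplex is determined by its k-cells, so cotrees can be indexed by the finite type of
    sets of k-cells. *)
Lemma skel_with_cells_in L : subcomplex L -> skel X k `<=` L ->
  L `<=` skel X k.+1 -> L = skel_with (cells_in L).
Proof.
move=> [_ [P LP]] kL Lk; rewrite [LHS]LP; congr bigcup; apply/funext => p.
apply/propext; split=> [Pp|[pk|[i iL ->]]].
- have : cell (projT2 p) `<=` skel X k.+1.
    by apply: subset_trans Lk; rewrite LP; apply/cell_sub_bigcup.
  move=> /cell_sub_skel; rewrite ltnS leq_eqVlt => /orP[/eqP pk|pk]; last by left.
  have [i pE] : exists i : 'I_(ncells X k), p = existT _ k i.
    by case: p pk {Pp} => j i /= <-; exists i.
  right; exists i; rewrite // inE; apply/asboolP; rewrite LP.
  by apply/(cell_sub_bigcup P (existT _ k i)); rewrite -pE.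
- apply/cell_sub_bigcup; rewrite -LP; apply: subset_trans kL.
  exact/cell_sub_skel.
apply/(cell_sub_bigcup P (existT _ k i)); rewrite -LP.
by move: iL; rewrite inE => /asboolP.
Qed.

(** Replacing open cells by closed ones does not enlarge the union, since the sphere of each cell
    maps into lower cells; a finite union of closed sets remains. *)
Lemma closed_skel_with S : closed (skel_with S).
Proof.
have -> : skel_with S = \bigcup_(p in cotree_cells S) (cw_char (projT2 p) @` setT).
  apply/seteqP; split=> x [p Sp]; first by move=> [y _ <-]; exists p => //; exists y.
  move=> [y _ <-]; have : disk_set (set_val y) by exact: set_valP.
  rewrite /disk_set /= le_eqVlt => /orP[/eqP y1|y1]; last by exists p => //; exists y.
  apply: skel_sub_skel_with.
  have [q qp yq] : skel X (projT1 p) (cw_char (projT2 p) y).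
    by apply: (cw_boundary (i := projT2 p)); exists y.
  exists q => //=; apply: (leq_trans qp).
  by case: Sp => [/ltnW//|[i _ ->]].
apply: closed_bigcup => [|p _]; last exact: closed_char.
(* The dimensions are at most [k], so the indices come from a finite type. *)
pose h (p : {j : 'I_k.+1 & 'I_(ncells X j)}) : {j : nat & 'I_(ncells X j)} :=
  existT _ (val (tag p)) (tagged p).
apply: (@sub_finite_set _ _ (h @` setT)); last exact/finite_image/finite_finset.
move=> p Sp; have pk : (projT1 p < k.+1)%N.
  by case: Sp => [/ltnW//|[i _ ->]] /=.
by case: p pk {Sp} => j i /= jk; exists (existT _ (Ordinal jk) i).
Qed.

Section Chains.
Variable A : comNzRingType.

Lemma chains_on_skel_with S (c : 'rV[A]_(ncells X k)) :
  chains_on (skel_with S) c <-> forall i, i \notin S -> c 0 i = 0.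
Proof.
split=> cS i; last by move=> ci; apply/cell_sub_skel_with; apply: contraNT ci => /cS->.
by move=> iS; apply/eqP; apply: contraNT iS => /cS /cell_sub_skel_with.
Qed.

Lemma chains_on_skel_with_top S (d : 'rV[A]_(ncells X k.+1)) :
  chains_on (skel_with S) d <-> d = 0.
Proof.
split=> [dS|->]; last by have [] := chains_on_subspace A k.+1 (skel_with S).
apply/rowP => i; rewrite mxE; apply/eqP/negP => /negP/dS iS.
have := (cell_sub_skel k.+1 (existT _ k.+1 i)).1 (subset_trans iS (@skel_with_sub_skel S)).
by rewrite ltnn.
Qed.

Lemma chains_on_skel_with_pred S (c : 'rV[A]_(ncells X k.-1)) :
  (0 < k)%N -> chains_on (skel_with S) c.
Proof.
move=> k0 i _; apply: subset_trans (@skel_sub_skel_with S).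
by apply/(cell_sub_skel k (existT _ k.-1 i)); rewrite /= prednK.
Qed.

End Chains.

End SpanningCotreeTheory.

(** * Spanning cotrees as complements of the boundaries *)

Section ComplementaryCells.
Variables (R : realType) (X : finite_cw R) (o : orientation X).

(** The subcomplex has no (k+1)-cells, so its only k-boundary is 0, and its k-chains are those
    supported on [S]. *)
Lemma hincl_iso_skel_with k (S : {set 'I_(ncells X k)}) :
  hincl_iso o rat (skel_with S) k <->
  (forall z : 'rV[rat]_(ncells X k), (forall i, i \notin S -> z 0 i = 0) ->
     z *m bdmx o rat k = 0 -> (exists y, z = y *m bdmx o rat k.+1) -> z = 0) /\
  (forall z : 'rV[rat]_(ncells X k), z *m bdmx o rat k = 0 ->
     exists (z' : 'rV[rat]_(ncells X k)) y,
       [/\ forall i, i \notin S -> z' 0 i = 0, z' *m bdmx o rat k = 0 &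
           z = z' + y *m bdmx o rat k.+1]).
Proof.
rewrite hincl_isoP; split=> -[inj surj]; split.
- move=> z zS zc [y zy].
  have [| |d /chains_on_skel_with_top-> ->] := (boundaries_set0 _ _ _).1 (inj z _ _).
  + by split; [apply/chains_on_skel_with|rewrite zc; apply/chains_on_set0].
  + by apply/boundaries_set0; exists y.
  by rewrite mul0mx.
- move=> z zc; have [|z' [/chains_on_skel_with z'S /chains_on_set0 z'c]] := surj z.
    by split=> //; rewrite zc; apply/chains_on_set0.
  move=> /boundaries_set0[y _ zE]; exists z', y; split=> //.
  by rewrite -zE addrC subrK.
- move=> z [/chains_on_skel_with zS /chains_on_set0 zc] /boundaries_set0[y _ zy].
  rewrite (inj z zS zc (ex_intro _ y zy)); exact: boundaries0.
move=> z [_ /chains_on_set0 zc]; have [z' [y [z'S z'c zE]]] := surj z zc.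
exists z'; first by split; [apply/chains_on_skel_with|rewrite z'c; apply/chains_on_set0].
by apply/boundaries_set0; exists y => //; rewrite zE addrAC subrr add0r.
Qed.

(** The subcomplex contains all (k-1)-cells, so surjectivity is automatic; injectivity says that
    every boundary of a k-chain already bounds a chain on [S]. *)
Lemma hincl_iso_skel_with_pred k (S : {set 'I_(ncells X k)}) : (0 < k)%N ->
  hincl_iso o rat (skel_with S) k.-1 <->
  (forall y : 'rV[rat]_(ncells X k), exists y' : 'rV[rat]_(ncells X k),
     (forall i, i \notin S -> y' 0 i = 0) /\ y *m bdmx o rat k = y' *m bdmx o rat k).
Proof.
case: k S => // k S _ /=; rewrite hincl_isoP; split=> [[inj _] y|surj].
  have [| |d /chains_on_skel_with dS yd] :=
      (boundaries_set0 _ _ _).1 (inj (y *m bdmx o rat k.+1) _ _).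
  - split; first exact: (@chains_on_skel_with_pred _ _ k.+1).
    by rewrite -mulmxA bdmx_mul0 mulmx0; apply/chains_on_set0.
  - by apply/boundaries_set0; exists y.
  by exists d.
split=> [z zc /boundaries_set0[y _ zy]|z [_ zc]].
  have [y' [y'S yy']] := surj y; apply/boundaries_set0; exists y'.
    exact/chains_on_skel_with.
  by rewrite zy yy'.
exists z; first by split=> //; exact: (@chains_on_skel_with_pred _ _ k.+1).
by rewrite subrr; exact: boundaries0.
Qed.

(** For spanning, degree k-1 gives a chain on [S] with the same boundary as [z]; the difference is a
    cycle, which degree k splits into a chain on [S] and a boundary. Conversely, in such a splitting
    the chain on [S] has the boundary of [z]. *)
Lemma spanning_cotree_skel_with k (S : {set 'I_(ncells X k)}) :
  spanning_cotree o k (skel_with S) <-> complementary (bdmx o rat k.+1) S.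
Proof.
split=> [[_ _ _ /hincl_iso_skel_with[inj surj] iso_pred]|[S0 S1]].
  split=> [y yS|z].
    apply: inj => //; last by exists y.
    by rewrite -mulmxA bdmx_mul0 mulmx0.
  have [z' [z'S z'E]] : exists z' : 'rV[rat]_(ncells X k),
      (forall i, i \notin S -> z' 0 i = 0) /\ z *m bdmx o rat k = z' *m bdmx o rat k.
    (* In degree 0 every chain is a cycle, so 0 already has the same boundary as [z]. *)
    have [k0|k_gt0] := posnP k; last first.
      exact: (hincl_iso_skel_with_pred S k_gt0).1 (iso_pred k_gt0) z.
    exists 0; split; first by move=> i _; rewrite mxE.
    by rewrite mul0mx; case: (k) k0 z => // _ z; rewrite mulmx0.
  have [|z'' [y [z''S _ zE]]] := surj (z - z'); first by rewrite mulmxBl z'E subrr.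
  exists y => j jS; move/rowP: zE => /(_ j).
  by rewrite !mxE z'S // z''S // subr0 add0r => ->.
have decomp z : exists (s : 'rV[rat]_(ncells X k)) y,
    (forall i, i \notin S -> s 0 i = 0) /\ z = s + y *m bdmx o rat k.+1.
  have [y yS] := S1 z; exists (z - y *m bdmx o rat k.+1), y; split; last by rewrite subrK.
  by move=> i iS; rewrite !mxE -yS // mxE subrr.
split.
- split; first exact: closed_skel_with.
  by exists (cotree_cells S).
- exact: skel_sub_skel_with.
- exact: skel_with_sub_skel.
- apply/hincl_iso_skel_with; split=> [z zS zc [y zy]|z zc].
    by rewrite zy; apply: S0; rewrite -zy.
  have [s [y [sS zE]]] := decomp z; exists s, y; split=> //.
  by move: zc; rewrite zE mulmxDl -mulmxA bdmx_mul0 mulmx0 addr0.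
move=> k_gt0; apply/hincl_iso_skel_with_pred => // z.
have [s [y [sS zE]]] := decomp z; exists s; split=> //.
by rewrite zE mulmxDl -mulmxA bdmx_mul0 mulmx0 addr0.
Qed.

(** Every k-chain is a relative cycle because its boundary lies in the (k-1)-skeleton, and relative
    boundaries are arbitrary on [S]. *)
Lemma homology_rel_skel_with k (S : {set 'I_(ncells X k)}) :
  homology o int setT (skel_with S) k = relative_cosets (incidence o k) S.
Proof.
have bdE : bdmx o int k.+1 = incidence o k.
  by apply/matrixP => i j; rewrite mxE intz.
have hclassE z : hclass o setT (skel_with S) z =
    [set w | exists y : 'rV[int]_(ncells X k.+1),
       forall j, j \notin S -> (w - z) 0 j = (y *m incidence o k) 0 j].
  apply/seteqP; split=> w.
    move=> [y [t [_ /chains_on_skel_with tS wE]]]; exists y => j jS.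
    by rewrite wE mxE tS // addr0 bdE.
  move=> [y wE]; exists y, (w - z - y *m incidence o k); split=> //.
    by apply/chains_on_skel_with => i iS; rewrite mxE wE // [X in _ + X]mxE subrr.
  by rewrite bdE [RHS]addrC subrK.
rewrite /homology (_ : cycles o int setT (skel_with S) k = setT).
  by apply/eq_imagel => z _; exact: hclassE.
apply/seteqP; split=> // z _; split=> //.
have [k0|k_gt0] := posnP k; last exact: chains_on_skel_with_pred.
have -> : z *m bdmx o int k = 0 by case: (k) k0 z => // _ z; rewrite mulmx0.
by have [] := chains_on_subspace int k.-1 (skel_with S).
Qed.

End ComplementaryCells.

(** * Harmonic representatives *)

Section Upsilon.
Variables (R : realType) (X : finite_cw R) (o : orientation X) (k : nat).

Let good (S : {set 'I_(ncells X k)}) := `[< complementary (bdmx o rat k.+1) S >].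

(** The map [skel_with] is a bijection from complementary sets of k-cells to spanning cotrees, with
    inverse [cells_in]. *)
Lemma big_spanning_cotree (idx : nat) (op : Monoid.com_law idx) (F : set X -> nat) :
  \big[op/idx]_(L \in spanning_cotree o k) F L =
  \big[op/idx]_(S | good S) F (skel_with S).
Proof.
have -> : spanning_cotree o k = @skel_with _ X k @` [set` good].
  apply/seteqP; split=> [L LC|_ [S /asboolP SC <-]]; last exact/spanning_cotree_skel_with.
  have [Lsub kL Lk _ _] := LC; have LE := skel_with_cells_in Lsub kL Lk.
  exists (cells_in k L) => //; apply/asboolP/spanning_cotree_skel_with.
  by rewrite -LE.
rewrite fsbig_image => [|S S' _ _ /(congr1 (cells_in k))]; last first.
  by rewrite !cells_in_skel_with.
rewrite -(@bigfs _ _ op _ (index_enum _)) ?index_enum_uniq // => S _.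
by rewrite mem_index_enum.
Qed.

(** The sum of squared weights is the Gram determinant, which makes [h] integral; the product [P] of
    the weights then rescales the integral vector. *)
Lemma Upsilon_clears_denominators (z : 'rV[int]_(ncells X k))
    (h : 'rV[rat]_(ncells X k)) (y : 'rV[rat]_(ncells X k.+1)) :
  h - map_mx intr z = y *m bdmx o rat k.+1 -> harmonic o h ->
  (0 < Upsilon o k)%N /\
  exists w : 'rV[int]_(ncells X k), (Upsilon o k)%:R *: h = map_mx intr w.
Proof.
move=> hz [_ h_coclosed].
have [r [M [U [V [AU MV M_free]]]]] := integer_row_basis (incidence o k).
pose wt (S : {set 'I_(ncells X k)}) := cotree_weight o k (skel_with S).
have wtP S : complementary (bdmx o rat k.+1) S ->
    relative_cosets (incidence o k) S #= `I_(wt S).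
  move=> SC; have [g [ginj Sg dN]] : exists g : 'I_r -> 'I_(ncells X k),
      [/\ injective g, ~: S = g @: 'I_r & \det (colsub g M) != 0].
    apply: (complementary_minor M_free).
    apply: (complementary_row_space (U := map_mx intr U) (V := map_mx intr V)) SC;
      by rewrite -map_mxM -?AU -?MV.
  have cN := card_relative_cosets AU MV ginj Sg dN.
  (* The finiteness contained in [cN] is what makes [fset_set] count all relative classes. *)
  by rewrite /wt /cotree_weight homology_rel_skel_with (card_fset_set cN).
have D_eq := gram_det_index AU MV M_free wtP.
have D_neq0 := gram_det_neq0 M_free.
have [w Dh] := gram_det_projection AU MV hz h_coclosed.
pose P := (\prod_(S | good S) wt S)%N.
have UE : Upsilon o k = ((\sum_(S | good S) wt S ^ 2) * P)%N.
  by rewrite /Upsilon !big_spanning_cotree.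
(* A weight 0 would leave no relative classes, yet the class of 0 exists. *)
have P_gt0 : (0 < P)%N.
  apply: prodn_cond_gt0 => S /asboolP/wtP; rewrite lt0n; case: eqP => // ->.
  by rewrite II0 card_eq0 => /eqP/seteqP[/(_ _ (ex_intro2 _ _ 0 I erefl))].
split.
  rewrite UE muln_gt0 P_gt0 andbT lt0n.
  by apply: contraNneq D_neq0 => D0; rewrite -D_eq D0.
exists (P%:Z *: w); rewrite UE natrM mulrC -scalerA map_mxZ -Dh -D_eq.
by [].
Qed.

End Upsilon.

Theorem theoremC (R : realType) (X : finite_cw R) (o : orientation X) (k : nat)
    (a : set 'rV[int]_(ncells X k)) (h : 'rV[rat]_(ncells X k)) :
  integral_class o a ->
  harmonic o h -> rational_image o a h ->
  forall i : 'I_(ncells X k), Zinv (Upsilon o k) (h 0 i).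
Proof.
move=> _ h_harm [z _ /boundaries_set0[y _ hz]] i.
have [U_gt0 [w wE]] := Upsilon_clears_denominators hz h_harm.
(* A single power of Upsilon suffices as denominator; its positivity justifies the cancellation. *)
exists (w 0 i), 1%N; rewrite expr1.
move/rowP: wE => /(_ i); rewrite !mxE => <-.
by rewrite mulrC mulKf // pnatr_eq0 -lt0n.
Qed.
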